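(* Let $\mathcal H^2$ be a two-dimensional complex Hilbert space with orthonormal basis $h_{01},h_{02}$, let $\lambda_0\in\mathbb C$ with $\operatorname{Im}\lambda_0>0$, let $T_m$ be the linear operator in $\mathcal H^2$ with matrix $\begin{pmatrix}\lambda_0&0\\0&\bar\lambda_0\end{pmatrix}$ in this basis, let $K:\mathbb C^2\to\mathcal H^2$ be given by $K(c_1,c_2)^T=\sqrt{\operatorname{Im}\lambda_0}\,(c_1h_{01}+c_2h_{02})$, let $J_m=\begin{pmatrix}1&0\\0&-1\end{pmatrix}$ on $\mathbb C^2$, and let $$\Theta_m=\begin{pmatrix}T_m&K&J_m\\ \mathcal H^2&&\mathbb C^2\end{pmatrix}$$ be the canonical L-system with main operator $T_m$, channel operator $K$ and directing operator $J_m$. Then the c-Entropy $\mathcal S_m$ of $\Theta_m$ is zero.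
   Context: $\operatorname{Im}T=\frac1{2i}(T-T^* )$. A canonical L-system is an array $\Theta=\begin{pmatrix}T&K&J\\ \mathcal H&&E\end{pmatrix}$, where $\mathcal H,E$ are Hilbert spaces with $\dim E<\infty$, $T$ is a bounded operator in $\mathcal H$ (main operator), $K:E\to\mathcal H$ is bounded (channel operator), $J$ is a bounded self-adjoint unitary operator in $E$ (directing operator), and $\operatorname{Im}T=KJK^*$. Its transfer function is $W_\Theta(z)=I-2iK^*(T-zI)^{-1}KJ$, $z\in\rho(T)$. The c-Entropy of $\Theta$ is $\mathcal S=-\operatorname{tr}\ln(|W_\Theta(-i)|)$, where $|W|=(W^*W)^{1/2}$. Convention: if $-i\notin\rho(T)$ or $W_\Theta(-i)$ is singular (here exactly when $\lambda_0=i$), $\mathcal S$ is understood as the limit in $[-\infty,+\infty]$ of $-\operatorname{tr}\ln(|W_\Theta(z)|)$ as $z\to -i$, $z\neq -i$. *)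

(* Defs.v *)
From HB Require Import structures.
From mathcomp Require Import all_boot all_order all_algebra.
From mathcomp Require Import complex ring lra.
From mathcomp Require Import all_classical all_reals all_analysis.

Set Implicit Arguments.
Unset Strict Implicit.
Unset Printing Implicit Defensive.

Import Order.TTheory GRing.Theory Num.Theory.
Import numFieldNormedType.Exports.

Local Open Scope classical_set_scope.
Local Open Scope ring_scope.
Local Open Scope complex_scope.

Section DotNorm.
Variables (R : realType) (V : lmodType R[i]) (ip : V -> V -> R[i]).

Definition dnorm (x : V) : R := Num.sqrt (complex.Re (ip x x)).

Definition dcauchy (u : nat -> V) : Prop :=
  forall e : R, 0 < e -> exists N, forall m n,
    (N <= m)%N -> (N <= n)%N -> dnorm (u m - u n) < e.

Definition dcvg (u : nat -> V) (l : V) : Prop :=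
  forall e : R, 0 < e -> exists N, forall n, (N <= n)%N -> dnorm (u n - l) < e.

End DotNorm.

HB.mixin Record Lmodule_isHilbert (R : realType) V of GRing.Lmodule R[i] V := {
  ip : {dot V for (@Num.conj R[i])};
  hilbert_complete : forall u : nat -> V,
    dcauchy ip u -> exists l, dcvg ip u l
}.

#[short(type="hilbertType")]
HB.structure Definition Hilbert (R : realType) :=
  {V of GRing.Lmodule R[i] V & Lmodule_isHilbert R V}.

#[short(type="finHilbertType")]
HB.structure Definition FinHilbert (R : realType) :=
  {V of Vector R[i] V & Lmodule_isHilbert R V}.

Section StandardHilbert.
Variables (R : realType) (n : nat).
Local Notation C := (R[i]).
Local Notation Cn := ('cV[C]_n).

Definition cdot (x y : Cn) : C := \sum_i x i 0 * (y i 0)^*.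

Lemma cdot_bilinear : bilinear_for *%R (Num.conj \; *%R) cdot.
Proof.
split=> [y|x] a u v; rewrite /cdot /= mulr_sumr -big_split /=;
  apply: eq_bigr => k _; rewrite !mxE.
- by rewrite mulrDl mulrA.
- by rewrite rmorphD rmorphM mulrDr mulrCA.
Qed.
HB.instance Definition _ := bilinear_isBilinear.Build C Cn Cn C
  *%R (Num.conj \; *%R) cdot cdot_bilinear.

Lemma cdot_hermitian x y : cdot x y = (-1) ^+ false * Num.conj (cdot y x).
Proof.
rewrite /cdot expr0 mul1r rmorph_sum; apply: eq_bigr => k _.
by rewrite rmorphM mulrC /=; congr (_ * _); rewrite -[LHS]conjcK.
Qed.
HB.instance Definition _ :=
  isHermitianSesquilinear.Build C Cn false Num.conj cdot cdot_hermitian.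

Lemma cdotxx x : cdot x x =
  (\sum_i (complex.Re (x i 0) ^+ 2 + complex.Im (x i 0) ^+ 2))%:C.
Proof.
rewrite /cdot raddf_sum; apply: eq_bigr => k _.
case: (x k 0) => a b; apply/eqP; rewrite eq_complex /= !expr2.
by apply/andP; split; apply/eqP; ring.
Qed.

Lemma cdot_pos x : x != 0 -> 0 < cdot x x.
Proof.
move=> x0; rewrite cdotxx ltcR lt_neqAle sumr_ge0 ?andbT; last first.
  by move=> k _; rewrite addr_ge0 ?sqr_ge0.
apply: contra x0; rewrite eq_sym psumr_eq0; last first.
  by move=> k _; rewrite addr_ge0 ?sqr_ge0.
move/allP=> h; apply/eqP/matrixP => i j; rewrite ord1 mxE.
have := h i (mem_index_enum i); rewrite /= paddr_eq0 ?sqr_ge0 // !sqrf_eq0.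
by case: (x i 0) => a b /= /andP[/eqP-> /eqP->].
Qed.
HB.instance Definition _ := isDotProduct.Build C Cn cdot cdot_pos.

Lemma dnorm_cdot_ge (x : Cn) k :
  `|complex.Re (x k 0)| <= dnorm cdot x /\ `|complex.Im (x k 0)| <= dnorm cdot x.
Proof.
rewrite /dnorm cdotxx /= (bigD1 k) //= -!sqrtr_sqr.
have h : 0 <= \sum_(i < n | i != k)
    (complex.Re (x i 0) ^+ 2 + complex.Im (x i 0) ^+ 2).
  by apply: sumr_ge0 => i _; rewrite addr_ge0 ?sqr_ge0.
have := sqr_ge0 (complex.Re (x k 0)); have := sqr_ge0 (complex.Im (x k 0)).
by move=> ? ?; split; apply: ler_wsqrtr; lra.
Qed.

Lemma real_cauchy_cvg (v : nat -> R) :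
  (forall e : R, 0 < e -> exists N, forall k m,
     (N <= k)%N -> (N <= m)%N -> `|v k - v m| < e) -> cvgn v.
Proof.
move=> hv; apply/cauchy_cvgP/cauchy_exP => e e0.
have [N hN] := hv e e0; exists (v N), N => // m /= hm.
exact: hN.
Qed.

Lemma cdot_complete (u : nat -> Cn) :
  dcauchy cdot u -> exists l, dcvg cdot u l.
Proof.
move=> hu.
have cRe k : cvgn (fun m => complex.Re (u m k 0)).
  apply: real_cauchy_cvg => e /hu[N hN]; exists N => p q hp hq.
  apply: le_lt_trans (hN _ _ hp hq).
  have [+ _] := dnorm_cdot_ge (u p - u q) k.
  by rewrite !mxE raddfB.
have cIm k : cvgn (fun m => complex.Im (u m k 0)).
  apply: real_cauchy_cvg => e /hu[N hN]; exists N => p q hp hq.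
  apply: le_lt_trans (hN _ _ hp hq).
  have [_ +] := dnorm_cdot_ge (u p - u q) k.
  by rewrite !mxE raddfB.
pose l : Cn := \col_k (limn (fun m => complex.Re (u m k 0)) +i*
                       limn (fun m => complex.Im (u m k 0))).
exists l.
have sq0 (v : nat -> R) : cvgn v -> (v m - limn v) ^+ 2 @[m --> \oo] --> (0 : R).
  move=> cv; rewrite -[X in _ --> X](mulr0 0) -[X in X * X](subrr (limn v)).
  under eq_fun do rewrite expr2.
  by apply: cvgM; apply: cvgB => //; apply: cvg_cst.
have f0 : (\sum_k ((complex.Re (u m k 0) - complex.Re (l k 0)) ^+ 2 +
        (complex.Im (u m k 0) - complex.Im (l k 0)) ^+ 2)) @[m --> \oo] --> (0 : R).
  rewrite [X in _ --> X](_ : 0 = \sum_(k < n) 0); last by rewrite big1.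
  apply: cvg_big => [|k _]; first exact: add_continuous.
  rewrite !mxE [X in _ --> X](_ : 0 = 0 + 0); last by rewrite addr0.
  by apply: cvgD; apply: sq0.
move=> e e0.
have /cvgrPdist_lt/(_ _ (exprn_gt0 2 e0))[N _ hN] := f0.
exists N => m /hN /=; rewrite sub0r normrN ger0_norm; last first.
  by apply: sumr_ge0 => k _; rewrite addr_ge0 ?sqr_ge0.
move=> hm; rewrite /dnorm cdotxx /= -(ger0_norm (ltW e0)) -sqrtr_sqr.
rewrite ltr_sqrt ?exprn_gt0 //; apply: le_lt_trans hm.
by apply: ler_sum => k _; rewrite !mxE !raddfB.
Qed.

HB.instance Definition _ :=
  Lmodule_isHilbert.Build R Cn cdot_complete.

End StandardHilbert.

Definition bounded_op (R : realType) (V W : hilbertType R) (A : V -> W) : Prop :=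
  exists M : R, forall x, dnorm ip (A x) <= M * dnorm ip x.

Definition is_onb (R : realType) (V : hilbertType R) n (e : 'I_n -> V) : Prop :=
  (forall i j, ip (e i) (e j) = (i == j)%:R) /\
  (forall x, exists c : 'I_n -> R[i], x = \sum_i c i *: e i).

(* [A] has matrix [M] in the basis [e]: the columns of [M] are the coordinates
   of the images of the basis vectors. *)
Definition has_matrix (R : realType) (V : hilbertType R) n (e : 'I_n -> V)
    (A : V -> V) (M : 'M[R[i]]_n) : Prop :=
  forall j, A (e j) = \sum_i M i j *: e i.

Definition is_adjoint (R : realType) (V W : hilbertType R)
    (A : V -> W) (B : W -> V) : Prop :=
  forall x y, ip (A x) y = ip x (B y).

(* Such a [B] is unique; for a bounded linear [A] it exists by Riesz. *)
Definition adjoint (R : realType) (V W : hilbertType R) (A : V -> W) : W -> V :=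
  xget (fun=> 0) [set B | is_adjoint A B].

Definition imop (R : realType) (V : hilbertType R) (A : V -> V) : V -> V :=
  fun x => (2 * 'i)^-1 *: (A x - adjoint A x).

Definition is_resolvent (R : realType) (V : hilbertType R) (A : V -> V)
    (z : R[i]) (S : V -> V) : Prop :=
  [/\ linear S, bounded_op S, cancel (fun x => A x - z *: x) S
    & cancel S (fun x => A x - z *: x)].

Definition resolvent_set (R : realType) (V : hilbertType R) (A : V -> V) :
    set R[i] :=
  [set z | exists S, is_resolvent A z S].

Definition resolvent (R : realType) (V : hilbertType R) (A : V -> V)
    (z : R[i]) : V -> V :=
  xget (fun=> 0) [set S | is_resolvent A z S].

Record lsystem (R : realType) (H : hilbertType R) (E : finHilbertType R) :=
  LSystem {
    main : {linear H -> H};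
    channel : {linear E -> H};
    directing : {linear E -> E};
    main_bounded : bounded_op main;
    channel_bounded : bounded_op channel;
    directing_bounded : bounded_op directing;
    directing_selfadjoint : adjoint directing = directing;
    directing_isometric : cancel directing (adjoint directing);
    directing_coisometric : cancel (adjoint directing) directing;
    lsystem_im : imop main = channel \o directing \o adjoint channel
  }.

Definition transfer (R : realType) (H : hilbertType R) (E : finHilbertType R)
    (Theta : lsystem H E) (z : R[i]) : E -> E :=
  fun x => x - (2 * 'i) *: adjoint (channel Theta)
    (resolvent (main Theta) z (channel Theta (directing Theta x))).

Definition positive_op (R : realType) (V : hilbertType R) (P : V -> V) : Prop :=
  linear P /\ forall x, 0 <= ip (P x) x.

(* |W|, the unique positive square root of W^* W *)
Definition opabs (R : realType) (E : finHilbertType R) (W : E -> E) : E -> E :=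
  xget (fun=> 0) [set P | positive_op P /\ P \o P = adjoint W \o W].

(* Functional calculus on a finite-dimensional space: [L] is diagonal in an
   orthonormal eigenbasis of [P], with the logarithms of the eigenvalues. *)
Definition is_opln (R : realType) (E : finHilbertType R) (P L : E -> E) : Prop :=
  linear L /\
  exists n (e : 'I_n -> E) (a : 'I_n -> R), is_onb e /\
    forall k, [/\ 0 < a k, P (e k) = (a k)%:C *: e k
                & L (e k) = (ln (a k))%:C *: e k].

Definition opln (R : realType) (E : finHilbertType R) (P : E -> E) : E -> E :=
  xget (fun=> 0) [set L | is_opln P L].

Definition optr (R : realType) (E : finHilbertType R) (A : E -> E) : R[i] :=
  \sum_(i < \dim {:E}) coord (vbasis {:E}) i (A (vbasis {:E})`_i).

(* The trace is real, since ln |W| is self-adjoint. *)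
Definition neg_tr_ln_abs (R : realType) (E : finHilbertType R) (W : E -> E) : R :=
  - complex.Re (optr (opln (opabs W))).

Definition regular_at (R : realType) (H : hilbertType R) (E : finHilbertType R)
    (Theta : lsystem H E) (z : R[i]) : Prop :=
  resolvent_set (main Theta) z /\ bijective (transfer Theta z).

(* A relation rather than a function, so that the limit carries its existence;
   its value is unique (lemma [c_entropy_unique]).  [R[i]^o] is [R[i]] with the
   topology of its modulus. *)
Definition is_c_entropy (R : realType) (H : hilbertType R)
    (E : finHilbertType R) (Theta : lsystem H E) (s : \bar R) : Prop :=
  (regular_at Theta (- 'i) ->
     s = (neg_tr_ln_abs (transfer Theta (- 'i)))%:E) /\
  (~ regular_at Theta (- 'i) ->
     (\forall z \near (- 'i : R[i]^o)^', regular_at Theta z) /\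
     (neg_tr_ln_abs (transfer Theta z))%:E @[z --> (- 'i : R[i]^o)^'] --> s).

Lemma c_entropy_unique (R : realType) (H : hilbertType R)
    (E : finHilbertType R) (Theta : lsystem H E) (s t : \bar R) :
  is_c_entropy Theta s -> is_c_entropy Theta t -> s = t.
Proof.
move=> [s1 s2] [t1 t2]; have [r|r] := pselect (regular_at Theta (- 'i)).
  by rewrite s1 // t1.
by have [_ hs] := s2 r; have [_ ht] := t2 r; apply: cvg_unique hs ht.
Qed.

Definition mx2 (R : realType) (a b c d : R[i]) : 'M[R[i]]_2 :=
  \matrix_(i, j) if i == 0 then (if j == 0 then a else b)
                 else (if j == 0 then c else d).

Definition pair2 (T : Type) (x y : T) : 'I_2 -> T :=
  fun k => if k == 0 then x else y.

Lemma adjointE (R : realType) (V W : hilbertType R) (A : V -> W) (B : W -> V) :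
  is_adjoint A B -> adjoint A = B.
Proof.
move=> AB; apply: xget_unique => // B' AB'; apply/funext => y.
apply/eqP; rewrite -subr_eq0; apply/negP => /negP d0.
have := neq0_dnorm_gt0 (s := ip) _ d0.
have -> z : ip z (B' y - B y) = ip z (B' y) - ip z (B y).
  exact: (linearBr ip).
by rewrite -(AB' _ y) -(AB _ y) subrr ltxx.
Qed.

Lemma scaling_bounded (R : realType) (V W : hilbertType R) (A : V -> W) (k : R) :
  0 <= k -> (forall x, ip (A x) (A x) = k%:C * ip x x) -> bounded_op A.
Proof.
move=> k0 h; exists (Num.sqrt k) => x; rewrite /dnorm h -sqrtrM // ler_wsqrtr //.
by case: (ip x x) => a b /=; rewrite mul0r subr0.
Qed.

(* The operators diag(l, l^* ), K, diag(1, -1) do form an L-system, on any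
   two-dimensional Hilbert space. *)
Section Existence.
Variables (R : realType) (H : hilbertType R) (h1 h2 : H) (l : R[i]).
Hypothesis onb : is_onb (pair2 h1 h2).
Hypothesis l0 : 0 < complex.Im l.
Local Notation C2 := ('cV[R[i]]_2).
Local Notation cj := (@Num.conj R[i]).
Local Notation s := ((Num.sqrt (complex.Im l))%:C).

Let h11 : ip h1 h1 = 1. Proof. by have := onb.1 0 0. Qed.
Let h12 : ip h1 h2 = 0. Proof. by have := onb.1 0 1. Qed.
Let h21 : ip h2 h1 = 0. Proof. by have := onb.1 1 0. Qed.
Let h22 : ip h2 h2 = 1. Proof. by have := onb.1 1 1. Qed.

Let ipDl (V : hilbertType R) (x y z : V) : ip (x + y) z = ip x z + ip y z.
Proof. exact: (linearDl ip). Qed.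
Let ipDr (V : hilbertType R) (x y z : V) : ip z (x + y) = ip z x + ip z y.
Proof. exact: (linearDr ip). Qed.
Let ipZl (V : hilbertType R) a (x z : V) : ip (a *: x) z = a * ip x z.
Proof. exact: (linearZl_LR ip). Qed.
Let ipZr (V : hilbertType R) a (x z : V) : ip z (a *: x) = cj a * ip z x.
Proof. exact: (linearZr_LR ip). Qed.
Let ipC (V : hilbertType R) (x y : V) : cj (ip y x) = ip x y.
Proof. by rewrite [RHS](hermC ip) expr0 mul1r. Qed.
Let cM (a b : R[i]) : cj (a * b) = cj a * cj b. Proof. exact: rmorphM. Qed.
Let cN (a : R[i]) : cj (- a) = - cj a. Proof. exact: rmorphN. Qed.
Let cjK (a : R[i]) : cj (cj a) = a. Proof. exact: conjcK. Qed.
Let ipE := (ipDl, ipDr, ipZl, ipZr, h11, h12, h21, h22).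
Let ip2 (x y : C2) : ip x y = x 0 0 * cj (y 0 0) + x 1 0 * cj (y 1 0).
Proof.
have -> : ip x y = cdot x y by [].
rewrite /cdot !big_ord_recl big_ord0 addr0.
by have -> : lift ord0 ord0 = 1 :> 'I_2 by apply/val_inj.
Qed.

Let expand x : x = ip x h1 *: h1 + ip x h2 *: h2.
Proof.
have [_ /(_ x)[c]] := onb; rewrite !big_ord_recl big_ord0 addr0 /pair2 /= => xE.
by rewrite {2 3}xE !ipE !(mulr0, mulr1, addr0, add0r) -xE.
Qed.

Let T0 (x : H) : H := (l * ip x h1) *: h1 + (cj l * ip x h2) *: h2.
Let K0 (c : C2) : H := s *: (c 0 0 *: h1 + c 1 0 *: h2).
Let J0 (c : C2) : C2 := mx2 1 0 0 (-1) *m c.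
Let T0a (x : H) : H := (cj l * ip x h1) *: h1 + (l * ip x h2) *: h2.
Let K0a (x : H) : C2 := s *: \col_i ip x (pair2 h1 h2 i).

Let T0_lin : linear T0.
Proof.
move=> a x y; rewrite /T0 !ipE scalerDr !scalerA addrACA -!scalerDl.
by congr (_ *: _ + _ *: _); ring.
Qed.
HB.instance Definition _ := GRing.isLinear.Build R[i] H H _ T0 T0_lin.
Let K0_lin : linear K0.
Proof.
move=> a x y; rewrite /K0 !mxE !scalerDr !scalerA addrACA -!scalerDl.
by congr (_ *: _ + _ *: _); ring.
Qed.
HB.instance Definition _ := GRing.isLinear.Build R[i] C2 H _ K0 K0_lin.
Let J0_lin : linear J0.
Proof. by move=> a x y; rewrite /J0 linearP. Qed.
HB.instance Definition _ := GRing.isLinear.Build R[i] C2 C2 _ J0 J0_lin.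

Let J00 c : J0 c 0 0 = c 0 0.
Proof. by rewrite !mxE !big_ord_recl big_ord0 !mxE /= mul1r mul0r !addr0. Qed.
Let J01 c : J0 c 1 0 = - c 1 0.
Proof.
rewrite !mxE !big_ord_recl big_ord0 !mxE /= mul0r addr0 add0r mulN1r.
by congr (- c _ _); apply/val_inj.
Qed.

Let s_real : cj s = s. Proof. exact: conjc_real. Qed.
Let s2 : s * s = (complex.Im l)%:C.
Proof. by rewrite -rmorphM -expr2 sqr_sqrtr // ltW. Qed.

Let T0_adj : adjoint T0 = T0a.
Proof.
apply: adjointE => x y; rewrite /T0 /T0a !ipE !cM cjK !ipC; ring.
Qed.
Let K0_adj : adjoint K0 = K0a.
Proof.
apply: adjointE => x y; rewrite /K0 /K0a ipZr ip2 !ipE !mxE /= !ipC s_real.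
ring.
Qed.
Let J0_adj : adjoint J0 = J0.
Proof. by apply: adjointE => x y; rewrite !ip2 !J00 !J01 cN mulrN mulNr. Qed.
Let J0K : cancel J0 J0.
Proof.
move=> c; apply/matrixP => i j; rewrite ord1.
have [->|->] : i = 0 \/ i = 1.
  by case: i => [[|[|//]] hi]; [left|right]; apply/val_inj.
- by rewrite !J00.
- by rewrite !J01 opprK.
Qed.

Let norm_sq (z : R[i]) :
  z * cj z = (complex.Re z ^+ 2 + complex.Im z ^+ 2)%:C.
Proof.
case: z => a b; apply/eqP; rewrite eq_complex /= !expr2.
by apply/andP; split; apply/eqP; ring.
Qed.

Let T0_bd : bounded_op T0.
Proof.
apply: (@scaling_bounded _ _ _ _ (complex.Re l ^+ 2 + complex.Im l ^+ 2)).
  by rewrite addr_ge0 ?sqr_ge0.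
move=> x; rewrite -norm_sq {3 4}(expand x) /T0 !ipE !cM !cjK; ring.
Qed.
Let K0_bd : bounded_op K0.
Proof.
apply: (@scaling_bounded _ _ _ _ (complex.Im l)); first exact: ltW.
move=> c; rewrite -s2 /K0 ip2 !ipE s_real; ring.
Qed.
Let J0_bd : bounded_op J0.
Proof.
apply: (@scaling_bounded _ _ _ _ 1) => // c.
rewrite !ip2 J00 J01 cN rmorph1; ring.
Qed.

Let T0_im : imop T0 = K0 \o J0 \o adjoint K0.
Proof.
rewrite /imop T0_adj K0_adj; apply/funext => x.
have lE : l - cj l = 2 * 'i * (complex.Im l)%:C.
  case: l => a b; apply/eqP; rewrite eq_complex /=.
  by apply/andP; split; apply/eqP; ring.
have i2 : (2 * 'i : R[i]) != 0.
  by rewrite mulf_neq0 ?pnatr_eq0 // neq0Ci.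
have -> : T0 x - T0a x = (l - cj l) *: (ip x h1 *: h1 - ip x h2 *: h2).
  rewrite /T0 /T0a opprD addrACA -(scalerBl _ _ h1) -(scalerBl _ _ h2).
  rewrite scalerBr !scalerA -scaleNr.
  by rewrite -!mulrBl -mulNr opprB.
rewrite lE scalerA mulrA mulVf // mul1r -s2 /comp /K0 J00 J01 !mxE /=.
rewrite /pair2 /= scaleNr -scalerA; congr (_ *: _).
by rewrite scalerBr !scalerA.
Qed.

Lemma lsystem_exists : exists Theta : lsystem H C2,
  [/\ has_matrix (pair2 h1 h2) (main Theta) (mx2 l 0 0 (l^*)),
      forall c, channel Theta c = s *: (c 0 0 *: h1 + c 1 0 *: h2)
    & forall c, directing Theta c = mx2 1 0 0 (-1) *m c].
Proof.
have J0_adjK : cancel J0 (adjoint J0) by rewrite J0_adj.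
have J0_adjK' : cancel (adjoint J0) J0 by rewrite J0_adj.
exists (@LSystem R H C2 T0 K0 J0 T0_bd K0_bd J0_bd J0_adj J0_adjK J0_adjK' T0_im).
split=> // j /=; rewrite !big_ord_recl big_ord0 !mxE /T0 /=.
have [->|->] : j = 0 \/ j = 1.
  by case: j => [[|[|//]] hi]; [left|right]; apply/val_inj.
- by rewrite /pair2 /= h11 h12 mulr1 mulr0 addr0.
- by rewrite /pair2 /= h21 h22 mulr1 mulr0 addr0.
Qed.

End Existence.

(* Main.v *)
Require Import Defs.
From HB Require Import structures.
From mathcomp Require Import all_boot all_order all_algebra.
From mathcomp Require Import complex.
From mathcomp Require Import all_classical all_reals all_analysis.
From mathcomp Require Import ring.

(** In the given bases everything is diagonal: the main operator has the
    eigenvalues d = (l, l^* ) on (h01, h02), the directing operator the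
    eigenvalues (1, -1) on the standard basis of C^2, and the channel operator
    is the isometry between these two bases times s = sqrt (Im l).  So for z
    outside {l, l^*} the transfer function is diagonal on the standard basis
    ([transfer_diagop]), and 2 i s^2 = l - l^* turns its two entries into

      w = (l^* - z) / (l - z)   and   (l - z) / (l^* - z) = w^-1.

    Hence |W| has the eigenvalues |w| and |w|^-1, and tr ln |W| =
    ln |w| - ln |w| = 0 for every such z.  This covers both clauses of the
    c-Entropy: the value at -i if -i is regular; otherwise the limit at -i,
    because all points of a punctured neighbourhood of -i avoid l and l^*
    and the function is constantly zero there.

    The operators |W| and ln |W| are specified by their properties, so
    computing them means proving that these properties determine them.  A
    positive square root P of A satisfies (P + a)(P - a) x = 0 on each
    eigenvector A x = a^2 x, and P + a is injective for a > 0
    ([positive_root_eigen]).  A logarithm L of P, diagonal in some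
    orthonormal eigenbasis of P, acts as ln p on the whole p-eigenspace of P,
    whatever that basis is ([opln_eigen]).  Finally, the trace taken in an
    arbitrary basis is the sum of the eigenvalues ([optr_diagop]). *)

Import Order.TTheory GRing.Theory Num.Theory.

Local Open Scope ring_scope.
Local Open Scope complex_scope.

(** * Inner products and conjugation *)

Section InnerProduct.
Context {R : realType} {V : hilbertType R}.
Implicit Types (a : R[i]) (x y z : V).

Lemma ipDl x y z : ip (x + y) z = ip x z + ip y z.
Proof. exact: (linearDl ip). Qed.

Lemma ipBl x y z : ip (x - y) z = ip x z - ip y z.
Proof. exact: (linearBl ip). Qed.

Lemma ipZl a x z : ip (a *: x) z = a * ip x z.
Proof. exact: (linearZl_LR ip). Qed.

Lemma ipZr a x z : ip z (a *: x) = Num.conj a * ip z x.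
Proof. exact: (linearZr_LR ip). Qed.

Lemma ip0l z : ip 0 z = 0.
Proof. by rewrite -(scale0r z) ipZl mul0r. Qed.

Lemma ip_suml I (r : seq I) (F : I -> V) z :
  ip (\sum_(k <- r) F k) z = \sum_(k <- r) ip (F k) z.
Proof.
by apply: (big_morph (fun x => ip x z)) => [x y|]; rewrite ?ipDl ?ip0l.
Qed.

Lemma ipC x y : Num.conj (ip y x) = ip x y.
Proof. by rewrite [RHS](hermC ip) expr0 mul1r. Qed.

Lemma ip_sumr I (r : seq I) (F : I -> V) z :
  ip z (\sum_(k <- r) F k) = \sum_(k <- r) ip z (F k).
Proof.
rewrite -ipC ip_suml rmorph_sum; apply: eq_bigr => k _; exact: ipC.
Qed.

Lemma ip_gt0 x : x != 0 -> 0 < ip x x.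
Proof. by move=> x0; have := neq0_dnorm_gt0 (s := ip) _ x0. Qed.

End InnerProduct.

Lemma conjM (R : rcfType) (a b : R[i]) :
  Num.conj (a * b) = Num.conj a * Num.conj b.
Proof. exact: rmorphM. Qed.

Lemma normr_normc (R : rcfType) (a : R[i]) : `|a| = (Normc.normc a)%:C.
Proof. by case: a. Qed.

Lemma normc2E (R : rcfType) (a : R[i]) : a * Num.conj a = (Normc.normc a ^+ 2)%:C.
Proof. by rewrite -normCK normr_normc rmorphXn. Qed.

(** * Diagonal operators in an orthonormal basis *)

Definition diagop {R : realType} {V : hilbertType R} {n} (e : 'I_n -> V)
    (d : 'I_n -> R[i]) : V -> V :=
  fun x => \sum_k (d k * ip x (e k)) *: e k.

Section Diagonal.
Context {R : realType} {V : hilbertType R} {n : nat} {e : 'I_n -> V}.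
Hypothesis onb : is_onb e.
Implicit Types (d : 'I_n -> R[i]) (x y : V).

Lemma onb_expand x : x = \sum_k ip x (e k) *: e k.
Proof.
have [orth /(_ x)[c xE]] := onb; rewrite {1}xE; apply: eq_bigr => k _.
rewrite xE ip_suml (bigD1 k)//= big1 ?addr0 => [|j jk].
  by rewrite ipZl orth eqxx mulr1.
by rewrite ipZl orth (negbTE jk) mulr0.
Qed.

Lemma onb_coordE (c : 'I_n -> R[i]) k : ip (\sum_j c j *: e j) (e k) = c k.
Proof.
rewrite ip_suml (bigD1 k)//= ipZl onb.1 eqxx mulr1 big1 ?addr0// => j jk.
by rewrite ipZl onb.1 (negbTE jk) mulr0.
Qed.

(** Equality of operators is checked below coordinate by coordinate, which
    reduces it to identities between complex numbers. *)
Lemma onb_eq x y : (forall k, ip x (e k) = ip y (e k)) -> x = y.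
Proof.
by move=> xy; rewrite (onb_expand x) (onb_expand y); under eq_bigr do rewrite xy.
Qed.

Lemma onb_ip x y : ip x y = \sum_k ip x (e k) * Num.conj (ip y (e k)).
Proof.
by rewrite {1}(onb_expand y) ip_sumr; apply: eq_bigr => k _; rewrite ipZr mulrC.
Qed.

Lemma onb_neq0 k : e k != 0.
Proof.
apply/eqP => ek0; have := onb.1 k k; rewrite eqxx ek0 ip0l => /esym/eqP.
by rewrite oner_eq0.
Qed.

Lemma diagop_coord d x k : ip (diagop e d x) (e k) = d k * ip x (e k).
Proof. exact: onb_coordE. Qed.

Lemma diagopE d k : diagop e d (e k) = d k *: e k.
Proof.
apply: onb_eq => j; rewrite diagop_coord ipZl onb.1.
by case: eqVneq => [->//|_]; rewrite !mulr0.
Qed.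

Lemma diagop_linear d : linear (diagop e d).
Proof.
by move=> a x y; apply: onb_eq => k; rewrite !(diagop_coord, ipDl, ipZl); ring.
Qed.

Lemma linear_diagop (A : V -> V) d :
  linear A -> (forall k, A (e k) = d k *: e k) -> A = diagop e d.
Proof.
move=> linA Ae; apply/funext => x.
pose A' := GRing.isLinear.Build _ _ _ _ A linA.
pose L : {linear V -> V} := HB.pack A A'.
rewrite -[A]/(L : V -> V) {1}(onb_expand x) linear_sum; apply: eq_bigr => k _.
by rewrite linearZ /= Ae scalerA mulrC.
Qed.

Lemma adjoint_diagop d : adjoint (diagop e d) = diagop e (fun k => Num.conj (d k)).
Proof.
apply: adjointE => x y; rewrite onb_ip [RHS]onb_ip; apply: eq_bigr => k _.
by rewrite !diagop_coord conjM conjCK; ring.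
Qed.

Lemma diagop_comp d d' : diagop e d \o diagop e d' = diagop e (fun k => d k * d' k).
Proof. by apply/funext => x; apply: onb_eq => k; rewrite !diagop_coord mulrA. Qed.

Lemma onb_dnorm x : dnorm ip x = Num.sqrt (\sum_k Normc.normc (ip x (e k)) ^+ 2).
Proof.
rewrite /dnorm onb_ip raddf_sum; congr Num.sqrt; apply: eq_bigr => k _.
by rewrite /= normc2E.
Qed.

(** By Parseval, any bound on all |d k|^2 bounds the square of the operator
    norm; their sum is such a bound, also when n = 0. *)
Lemma diagop_bounded d : bounded_op (diagop e d).
Proof.
pose M := \sum_k Normc.normc (d k) ^+ 2.
have M0 : 0 <= M by apply: sumr_ge0 => k _; exact: sqr_ge0.
exists (Num.sqrt M) => x; rewrite !onb_dnorm -sqrtrM // ler_wsqrtr //.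
rewrite mulr_sumr; apply: ler_sum => k _.
rewrite diagop_coord Normc.normcM exprMn ler_wpM2r ?sqr_ge0 //.
by rewrite /M (bigD1 k) //= lerDl sumr_ge0 // => j _; exact: sqr_ge0.
Qed.

Lemma diagop_resolvent d z : (forall k, d k != z) ->
  is_resolvent (diagop e d) z (diagop e (fun k => (d k - z)^-1)).
Proof.
move=> dz; have dz0 k : d k - z != 0 by rewrite subr_eq0.
split=> [||x|x]; [exact: diagop_linear|exact: diagop_bounded| |];
  apply: onb_eq => k; rewrite !(diagop_coord, ipBl, ipZl).
- by rewrite -mulrBl mulKf.
- by rewrite -mulrBl mulVKf.
Qed.

(** The diagonal operator on the right is a right inverse of the shifted
    operator, and every resolvent is a left inverse of it, so the two agree. *)
Lemma resolvent_diagop d z : (forall k, d k != z) ->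
  resolvent (diagop e d) z = diagop e (fun k => (d k - z)^-1).
Proof.
move=> dz; have [_ _ _ SK] := diagop_resolvent _ _ dz.
apply: xget_unique; first exact: diagop_resolvent.
by move=> S [_ _ KS _]; apply/funext => x; rewrite -[in LHS](SK x) KS.
Qed.

(** The basis vector of index k is in the kernel of the operator shifted by
    d k, which therefore has no left inverse. *)
Lemma resolvent_diagop_neq d z k : resolvent_set (diagop e d) z -> d k != z.
Proof.
case=> S [linS _ KS _]; apply/eqP => dz.
have S0 : S 0 = 0.
  by have := linS (-1) 0 0; rewrite scaler0 addr0 scaleN1r addNr.
have := KS (e k); rewrite diagopE dz subrr S0 => ek0.
by have := onb_neq0 k; rewrite -ek0 eqxx.
Qed.

Lemma diagop_bijective d : (forall k, d k != 0) -> bijective (diagop e d).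
Proof.
move=> d0; exists (diagop e (fun k => (d k)^-1)) => x;
  apply: onb_eq => k; rewrite !diagop_coord.
- by rewrite mulKf.
- by rewrite mulVKf.
Qed.

End Diagonal.

(** * Modulus, logarithm and trace of a diagonal operator *)

(** The vector f := P x - a x satisfies P f = - a f, so <P f, f> = - a |f|^2,
    and positivity of P forces f = 0. *)
Lemma positive_root_eigen (R : realType) (V : hilbertType R) (P : V -> V)
    (a : R) (x : V) :
  positive_op P -> 0 < a -> P (P x) = (a ^+ 2)%:C *: x -> P x = a%:C *: x.
Proof.
move=> [linP P0] a0 PPx; apply/eqP; rewrite -subr_eq0; apply/negPn/negP.
set f := P x - _ => f0.
have Pf : P f = - a%:C *: f.
  have -> : f = - a%:C *: x + P x by rewrite scaleNr addrC.
  by rewrite linP PPx scalerDr scalerA mulrNN rmorphXn expr2 addrC.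
have := P0 f; rewrite Pf ipZl mulNr oppr_ge0 lt_geF //.
by rewrite mulr_gt0 ?ltcR // ip_gt0.
Qed.

(** In the eigenbasis e that comes with L, the identity P x = p x says that
    each k has a k = p or a zero coordinate of x along e k.  In both cases L
    multiplies this coordinate by ln p. *)
Lemma opln_eigen (R : realType) (E : finHilbertType R) (P L : E -> E)
    (p : R) (x : E) :
  linear P -> is_opln P L -> P x = p%:C *: x -> L x = (ln p)%:C *: x.
Proof.
move=> linP [linL [n [e [a [onb PL]]]]] Px.
have PE : P = diagop e (fun k => (a k)%:C).
  by apply: (linear_diagop onb) => // k; have [] := PL k.
have -> : L = diagop e (fun k => (ln (a k))%:C).
  by apply: (linear_diagop onb) => // k; have [] := PL k.
apply: (onb_eq onb) => k; rewrite (diagop_coord onb) ipZl.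
have := diagop_coord onb (fun k => (a k)%:C) x k; rewrite -PE Px ipZl.
have [->|xk0 /(mulIf xk0)/complexI ->//] := eqVneq (ip x (e k)) 0.
by rewrite !mulr0.
Qed.

Section Entropy.
Context {R : realType} {E : finHilbertType R} {n : nat} {e : 'I_n -> E}.
Hypothesis onb : is_onb e.

Lemma opabs_diagop (d : 'I_n -> R[i]) : (forall k, d k != 0) ->
  opabs (diagop e d) = diagop e (fun k => (Normc.normc (d k))%:C).
Proof.
move=> d0.
have WW : adjoint (diagop e d) \o diagop e d =
    diagop e (fun k => (Normc.normc (d k) ^+ 2)%:C).
  rewrite (adjoint_diagop onb) (diagop_comp onb).
  by congr (diagop e); apply/funext => k; rewrite mulrC normc2E.
apply: xget_unique => [|P [posP PP]].
  split; last first.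
    rewrite WW (diagop_comp onb).
    by congr (diagop e); apply/funext => k; rewrite -rmorphM.
  split=> [|x]; first exact: (diagop_linear onb).
  rewrite (onb_ip onb); apply: sumr_ge0 => k _.
  rewrite (diagop_coord onb) -mulrA normc2E -rmorphM lecR mulr_ge0 //.
  - by rewrite -lecR -normr_normc normr_ge0.
  - exact: sqr_ge0.
apply: (linear_diagop onb) => [|k]; first exact: posP.1.
apply: positive_root_eigen => //.
  by rewrite -ltcR -normr_normc normr_gt0.
by rewrite -[P _]/((P \o P) (e k)) PP WW (diagopE onb).
Qed.

Lemma opln_diagop (a : 'I_n -> R) : (forall k, 0 < a k) ->
  opln (diagop e (fun k => (a k)%:C)) = diagop e (fun k => (ln (a k))%:C).
Proof.
move=> a0; apply: xget_unique => [|L PL].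
  split; first exact: (diagop_linear onb).
  by exists n, e, a; split=> // k; split; rewrite ?(diagopE onb).
apply: (linear_diagop onb) => [|k]; first exact: PL.1.
apply: opln_eigen PL _; first exact: (diagop_linear onb).
by rewrite (diagopE onb).
Qed.

(** The coordinates c_i of e k in the basis b of the trace satisfy
    \sum_i c_i <b_i, e k> = <e k, e k> = 1, and this sum is the coefficient
    of d k in the trace. *)
Lemma optr_diagop (d : 'I_n -> R[i]) : optr (diagop e d) = \sum_k d k.
Proof.
rewrite /optr.
under eq_bigr => i _.
  rewrite /diagop linear_sum /=.
  under eq_bigr => k _ do rewrite linearZ /= -mulrA.
  over.
rewrite exchange_big; apply: eq_bigr => k _ /=.
rewrite -mulr_sumr -[RHS]mulr1; congr (_ * _).
transitivity (ip (\sum_i coord (vbasis {:E}) i (e k) *: (vbasis {:E})`_i) (e k)).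
  by rewrite ip_suml; apply: eq_bigr => i _; rewrite ipZl mulrC.
by rewrite -coord_vbasis ?memvf // onb.1 eqxx.
Qed.

Lemma neg_tr_ln_abs_diagop (d : 'I_n -> R[i]) : (forall k, d k != 0) ->
  neg_tr_ln_abs (diagop e d) = - \sum_k ln (Normc.normc (d k)).
Proof.
move=> d0; rewrite /neg_tr_ln_abs opabs_diagop // opln_diagop.
  by rewrite optr_diagop -rmorph_sum.
by move=> k; rewrite -ltcR -normr_normc normr_gt0.
Qed.

End Entropy.

(** * Transfer function of a diagonal L-system *)

Section Transfer.
Context {R : realType} {H : hilbertType R} {E : finHilbertType R} {n : nat}.
Context {e : 'I_n -> H} {f : 'I_n -> E} {Theta : lsystem H E}.
Context {d j : 'I_n -> R[i]} {s : R[i]}.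
Hypotheses (onbe : is_onb e) (onbf : is_onb f).
Hypothesis mainE : forall k, main Theta (e k) = d k *: e k.
Hypothesis channelE : forall k, channel Theta (f k) = s *: e k.
Hypothesis directingE : forall k, directing Theta (f k) = j k *: f k.

Lemma main_diagop : main Theta = diagop e d :> (H -> H).
Proof. by apply: (linear_diagop onbe) => //; exact: linearP. Qed.

Lemma channel_coord x k : ip (channel Theta x) (e k) = s * ip x (f k).
Proof.
rewrite {1}(onb_expand onbf x) linear_sum -(onb_coordE onbe (fun k => _ * ip x (f k))).
by under eq_bigr do rewrite linearZ /= channelE scalerA mulrC.
Qed.

Lemma adjoint_channel_coord y k :
  ip (adjoint (channel Theta) y) (f k) = Num.conj s * ip y (e k).
Proof.
rewrite -[RHS](onb_coordE onbf (fun k => _ * ip y (e k))); congr (ip _ _).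
move: y; apply/funeqP/adjointE => x y; rewrite (onb_ip onbe) (onb_ip onbf).
apply: eq_bigr => i _; rewrite channel_coord (onb_coordE onbf) conjM conjCK.
ring.
Qed.

(** On f k, the operator J multiplies by j k, K passes to s e k, the
    resolvent divides by d k - z, and K^* returns to f k with the factor
    s^*. *)
Lemma transfer_diagop z : (forall k, d k != z) ->
  transfer Theta z =
    diagop f (fun k => 1 - 2 * 'i * (s * Num.conj s) * j k / (d k - z)).
Proof.
move=> dz; apply/funext => x; apply: (onb_eq onbf) => k.
rewrite (diagop_coord onbf) /transfer ipBl ipZl adjoint_channel_coord.
rewrite main_diagop (resolvent_diagop onbe) // (diagop_coord onbe) channel_coord.
have -> : directing Theta = diagop f j :> (E -> E).
  by apply: (linear_diagop onbf) => //; exact: linearP.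
by rewrite (diagop_coord onbf); ring.
Qed.

Lemma main_resolvent_set z : resolvent_set (main Theta) z <-> forall k, d k != z.
Proof.
rewrite main_diagop; split=> [rz k|dz]; first exact: (resolvent_diagop_neq onbe).
by exists (diagop e (fun k => (d k - z)^-1)); exact: (diagop_resolvent onbe).
Qed.

End Transfer.

(** * The two-dimensional model *)

Lemma onb_delta (R : realType) n :
  is_onb (fun k : 'I_n => delta_mx k 0 : 'cV[R[i]]_n).
Proof.
split=> [i k|x]; last first.
  by exists (fun k => x k 0); apply/matrixP => i j; rewrite ord1 {1}[x]matrix_sum_delta;
    under eq_bigr do rewrite big_ord1.
have -> : ip (delta_mx i 0 : 'cV[R[i]]_n) (delta_mx k 0) =
  cdot (delta_mx i 0) (delta_mx k 0) by [].
rewrite /cdot (bigD1 i) //= big1 ?addr0 => [|l li]; last first.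
  by rewrite !mxE (negbTE li) /= mul0r.
by rewrite !mxE !eqxx /= mul1r andbT rmorph_nat.
Qed.

Lemma near_dnbhs_neq (T : topologicalType) (p q : T) :
  accessible_space T -> (\forall x \near p^', x != q)%classic.
Proof.
move=> accT; have [<-|pq] := eqVneq p q; first exact: nbhs_dnbhs_neq.
apply: nbhs_dnbhs; have oq : open (~` [set q])%classic.
  by apply: closed_openC; exact: accessible_closed_set1.
have := open_nbhs_nbhs (conj oq (elimN eqP pq : (~` [set q])%classic p)).
by apply: filterS => x /eqP.
Qed.

Lemma Im_conj_sub (R : rcfType) (l : R[i]) :
  2 * 'i * (complex.Im l)%:C = l - Num.conj l.
Proof.
case: l => a b; apply/eqP; rewrite eq_complex /=.
by apply/andP; split; apply/eqP; ring.
Qed.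

Lemma ord2_ind (P : 'I_2 -> Prop) : P 0 -> P 1 -> forall k, P k.
Proof.
move=> P0 P1 [[|[|//]] hi].
- by rewrite (_ : Ordinal hi = 0) //; apply: val_inj.
- by rewrite (_ : Ordinal hi = 1) //; apply: val_inj.
Qed.

Theorem theorem3 (R : realType) (H : hilbertType R) (h01 h02 : H)
    (lambda0 : R[i]) (Theta_m : lsystem H 'cV[R[i]]_2) :
  is_onb (pair2 h01 h02) ->
  0 < complex.Im lambda0 ->
  has_matrix (pair2 h01 h02) (main Theta_m)
    (mx2 lambda0 0
         0 (lambda0^*)) ->
  (forall c : 'cV[R[i]]_2,
     channel Theta_m c =
     (Num.sqrt (complex.Im lambda0))%:C *: (c 0 0 *: h01 + c 1 0 *: h02)) ->
  (forall c : 'cV[R[i]]_2,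
     directing Theta_m c = mx2 1 0
                               0 (-1) *m c) ->
  is_c_entropy Theta_m 0%E.
Proof.
move=> onbe l0 mainE channelE directingE.
pose l := lambda0; pose cl := Num.conj l; pose s := (Num.sqrt (complex.Im l))%:C.
pose f k : 'cV[R[i]]_2 := delta_mx k 0; have onbf : is_onb f := onb_delta R 2.
have Te k : main Theta_m (pair2 h01 h02 k) = pair2 l cl k *: pair2 h01 h02 k.
  move: k; apply: ord2_ind; rewrite mainE !big_ord_recl big_ord0 !mxE /pair2 /=.
  - by rewrite scale0r !addr0.
  - by rewrite scale0r add0r addr0.
have Kf k : channel Theta_m (f k) = s *: pair2 h01 h02 k.
  move: k; apply: ord2_ind; rewrite channelE !mxE /pair2 /= scale1r scale0r.
  - by rewrite addr0.
  - by rewrite add0r.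
have Jf k : directing Theta_m (f k) = pair2 1 (-1) k *: f k.
  rewrite directingE; apply/matrixP => i m; rewrite ord1 !mxE {m}.
  rewrite !big_ord_recl big_ord0 !mxE.
  by move: k; apply: ord2_ind; move: i; apply: ord2_ind; rewrite /pair2 /=; ring.
have ss : s * Num.conj s = (complex.Im l)%:C.
  by rewrite conj_Creal ?complex_real// -rmorphM -expr2 sqr_sqrtr // ltW.
pose w z := pair2 ((cl - z) / (l - z)) ((l - z) / (cl - z)).
have WE z : l != z -> cl != z -> transfer Theta_m z = diagop f (w z).
  move=> lz clz; rewrite (transfer_diagop onbe onbf Te Kf Jf); last exact: ord2_ind.
  congr (diagop f); apply/funext; rewrite ss Im_conj_sub -/cl /w /pair2.
  by apply: ord2_ind => /=; field; rewrite subr_eq0.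
have w0 z : l != z -> cl != z -> forall k, w z k != 0.
  by move=> lz clz; apply: ord2_ind; rewrite mulf_neq0 ?invr_eq0 ?subr_eq0.
have regE z : resolvent_set (main Theta_m) z -> l != z /\ cl != z.
  by move/(main_resolvent_set onbe Te) => dz; split; [have := dz 0|have := dz 1].
have entropy0 z : l != z -> cl != z -> neg_tr_ln_abs (transfer Theta_m z) = 0.
  move=> lz clz; have wz0 := w0 z lz clz.
  have wpos k : 0 < Normc.normc (w z k) by rewrite -ltcR -normr_normc normr_gt0.
  rewrite WE // (neg_tr_ln_abs_diagop onbf) //.
  rewrite !big_ord_recl big_ord0 addr0 -lnM ?posrE// -Normc.normcM.
  rewrite /w /pair2 /= mulrA divfK ?subr_eq0// divff ?subr_eq0//.
  by rewrite Normc.normc1 ln1 oppr0.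
split=> [[/regE[lz clz] _]|_]; first by rewrite entropy0.
have near_l : (\forall z \near (- 'i : R[i]^o)^', l != z /\ cl != z)%classic.
  have acc : accessible_space R[i]^o by exact/hausdorff_accessible/norm_hausdorff.
  have nearNi q := near_dnbhs_neq R[i]^o (- 'i) q acc.
  by apply: filterS2 (nearNi l) (nearNi cl) => z zl zcl; rewrite !(eq_sym _ z).
split.
  near=> z; have [lz clz] : l != z /\ cl != z by near: z.
  split; first by apply/(main_resolvent_set onbe Te); exact: ord2_ind.
  by rewrite WE //; apply: (diagop_bijective onbf); exact: w0.
apply: cvg_near_cst; near=> z.
by have [lz clz] : l != z /\ cl != z by [near: z]; rewrite entropy0.
Unshelve. all: by end_near.
Qed.
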